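(* Let $G=(V,E)$ be a finite simple undirected graph, and let $\mathcal{G}$ be a game with player set $V$ that is both a graphical game on $G$ and a potential game with potential $\Phi\colon\mathcal{S}\to\mathbb{R}$. Then there exist functions $\Phi^C\colon \prod_{i\in C}\mathcal{S}_i\to\mathbb{R}$, one for each maximal clique $C\in\mathcal{C}(G)$, such that for all $a\in\mathcal{S}$ $$\Phi(a)=\sum_{C\in\mathcal{C}(G)}\Phi^C(a^C).$$
   Context: A game $\mathcal{G}$ has a finite player set $V$ with $|V|=n$; each player $i\in V$ has a finite (nonempty) strategy set $\mathcal{S}_i$; the set of strategy profiles is $\mathcal{S}=\prod_{i\in V}\mathcal{S}_i$; player $i$ has a real-valued utility $u_i\colon\mathcal{S}\to\mathbb{R}$. Fix an arbitrary distinguished strategy $o_i\in\mathcal{S}_i$ for each $i$; for $a\in\mathcal{S}$, $a^i$ denotes the profile obtained from $a$ by replacing $a_i$ with $o_i$. Graphical game on $G$: whenever $i\ne j$ and $(i,j)\notin E$, $u_i(a)=u_i(a^j)$ for all $a\in\mathcal{S}$ (this does not depend on the choice of the $o_i$). Potential game: there is a function $\Phi\colon\mathcal{S}\to\mathbb{R}$ (a potential) with $u_i(a)-u_i(a^i)=\Phi(a)-\Phi(a^i)$ for all $i\in V$, $a\in\mathcal{S}$. Potentials of a given game differ by constants; by convention the potential is normalized so that $\sum_{a\in\mathcal{S}}e^{\Phi(a)}=1$. $\mathcal{C}(G)$ is the set of maximal cliques of $G$, i.e. cliques not contained in strictly larger cliques (an isolated vertex is a maximal clique of size one). For $W\subseteq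 V$, $a^W\in\prod_{i\in W}\mathcal{S}_i$ denotes the restriction of $a$ to $W$. *)

(* Defs.v *)
From HB Require Import structures.
From mathcomp Require Import all_boot all_order all_algebra.
From mathcomp Require Import reals sequences exp.

Set Implicit Arguments.
Unset Strict Implicit.
Unset Printing Implicit Defensive.

Import GRing.Theory.
Local Open Scope ring_scope.

Definition profile (V : finType) (S : V -> finType) : finType :=
  {dffun forall i : V, S i}.

Definition subprofile (V : finType) (S : V -> finType) (W : {set V}) : finType :=
  {dffun forall i : {i : V | i \in W}, S (val i)}.

Definition restrict (V : finType) (S : V -> finType) (W : {set V})
    (a : profile S) : subprofile S W :=
  [ffun i : {i : V | i \in W} => a (val i)].

(* The profile written a^i in terms of the distinguished strategies o. *)
Definition reset (V : finType) (S : V -> finType) (o : forall i : V, S i)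
    (a : profile S) (i : V) : profile S :=
  [ffun j : V => if j == i then o j else a j].

Definition graphical_game (R : realType) (V : finType) (S : V -> finType)
    (o : forall i : V, S i) (E : rel V) (u : V -> profile S -> R) : Prop :=
  forall i j : V, i != j -> ~~ E i j ->
    forall a : profile S, u i a = u i (reset o a j).

Definition is_potential (R : realType) (V : finType) (S : V -> finType)
    (o : forall i : V, S i) (u : V -> profile S -> R) (Phi : profile S -> R)
    : Prop :=
  forall (i : V) (a : profile S),
    u i a - u i (reset o a i) = Phi a - Phi (reset o a i).

Definition normalized (R : realType) (V : finType) (S : V -> finType)
    (Phi : profile S -> R) : Prop :=
  \sum_(a : profile S) expR (Phi a) = 1.

Definition clique (V : finType) (E : rel V) (C : {set V}) : bool :=
  [forall x in C, forall y in C, (x != y) ==> E x y].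

Definition maximal_cliques (V : finType) (E : rel V) : {set {set V}} :=
  [set C : {set V} | maxset (clique E) C].

(* Main.v *)
(** A potential of a graphical game satisfies the second-order identity
    [Phi a - Phi a^i = Phi a^j - Phi a^{ij}] for every nonadjacent pair [i, j].
    If such a function depends only on the coordinates in a set [W] that is not
    a clique, then, for nonadjacent [i, j] in [W], the identity writes it as
    [Phi a^i + Phi a^j - Phi a^{ij}]; each term satisfies the same
    identity and depends on fewer coordinates.  Induction on [W] reduces to the
    case where [W] is a clique, which lies in a maximal one.  This replaces the
    Moebius inversion of the Hammersley-Clifford theorem. *)

Require Import Defs.
From mathcomp Require Import all_boot all_order all_algebra.
From mathcomp Require Import reals sequences exp.

Set Implicit Arguments.
Unset Strict Implicit.
Unset Printing Implicit Defensive.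

Import GRing.Theory.
Local Open Scope ring_scope.

Lemma resetC (V : finType) (S : V -> finType) (o : forall i : V, S i)
    (a : profile S) (i j : V) :
  reset o (reset o a i) j = reset o (reset o a j) i.
Proof. by apply/ffunP => k; rewrite !ffunE; do 2!case: ifP. Qed.

(** Players outside [W] get their distinguished strategy. Matching on [idP] supplies the membership
    proof that [b] needs as part of its argument. *)
Definition extend (V : finType) (S : V -> finType) (o : forall i : V, S i)
    (W : {set V}) (b : subprofile S W) : profile S :=
  [ffun i : V => if @idP (i \in W) is ReflectT iW then b (exist _ i iW)
                 else o i].

Lemma extend_restrict (V : finType) (S : V -> finType) (o : forall i : V, S i)
    (W : {set V}) (a : profile S) (i : V) :
  i \in W -> extend o (restrict W a) i = a i.
Proof. by move=> iW; rewrite ffunE; case: {-}_ / idP => // h; rewrite ffunE. Qed.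

Definition depends_on (V : finType) (S : V -> finType) (T : Type)
    (W : {set V}) (f : profile S -> T) : Prop :=
  forall a b : profile S, (forall i, i \in W -> a i = b i) -> f a = f b.

Lemma depends_on_reset (V : finType) (S : V -> finType) (o : forall i : V, S i)
    (T : Type) (W : {set V}) (f : profile S -> T) (i : V) :
  depends_on W f -> depends_on (W :\ i) (fun a => f (reset o a i)).
Proof.
move=> fW a b ab; apply: fW => j jW; rewrite !ffunE.
by case: eqVneq => // ji; apply: ab; rewrite !inE ji.
Qed.

Lemma depends_on_subset (V : finType) (S : V -> finType) (T : Type)
    (W W' : {set V}) (f : profile S -> T) :
  W \subset W' -> depends_on W f -> depends_on W' f.
Proof. by move=> /subsetP sW fW a b ab; apply: fW => i /sW/ab. Qed.

Definition clique_decomposable (Z : zmodType) (V : finType) (E : rel V)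
    (S : V -> finType) (f : profile S -> Z) : Prop :=
  exists fC : forall C : {set V}, subprofile S C -> Z,
    forall a, f a = \sum_(C in maximal_cliques E) fC C (restrict C a).

Lemma clique_decomposableD (Z : zmodType) (V : finType) (E : rel V)
    (S : V -> finType) (f g : profile S -> Z) :
  clique_decomposable E f -> clique_decomposable E g ->
  clique_decomposable E (fun a => f a + g a).
Proof.
move=> [fC fE] [gC gE]; exists (fun C b => fC C b + gC C b) => a.
by rewrite fE gE big_split.
Qed.

Lemma clique_decomposableN (Z : zmodType) (V : finType) (E : rel V)
    (S : V -> finType) (f : profile S -> Z) :
  clique_decomposable E f -> clique_decomposable E (fun a => - f a).
Proof.
by move=> [fC fE]; exists (fun C b => - fC C b) => a; rewrite fE sumrN.
Qed.

(** A single maximal clique [C0] containing [W] can carry all of [f]; the other maximal cliques get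
    the zero function. *)
Lemma clique_decomposable_clique (Z : zmodType) (V : finType) (E : rel V)
    (S : V -> finType) (o : forall i : V, S i) (W : {set V})
    (f : profile S -> Z) :
  clique E W -> depends_on W f -> clique_decomposable E f.
Proof.
move=> /maxset_exists[C0 C0max sWC0] /(depends_on_subset sWC0) fC0.
exists (fun C b => if C == C0 then f (extend o b) else 0) => a.
rewrite (bigD1 C0) ?inE //= eqxx big1 ?addr0 => [|C /andP[_ /negPf->]//].
by apply: fC0 => i iC0; rewrite extend_restrict.
Qed.

(** Vanishing mixed difference in [i] and [j]: equivalently, [f] is a sum of a function independent
    of [a i] and one independent of [a j]. *)
Definition pairwise_separable (Z : zmodType) (V : finType) (E : rel V)
    (S : V -> finType) (o : forall i : V, S i) (f : profile S -> Z) : Prop :=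
  forall i j, i != j -> ~~ E i j -> forall a,
    f a - f (reset o a i) = f (reset o a j) - f (reset o (reset o a i) j).

(** Resets commute, so this is the identity for [f] taken at the profile [reset o a k]. *)
Lemma pairwise_separable_reset (Z : zmodType) (V : finType) (E : rel V)
    (S : V -> finType) (o : forall i : V, S i) (f : profile S -> Z) (k : V) :
  pairwise_separable E o f ->
  pairwise_separable E o (fun a => f (reset o a k)).
Proof.
move=> fsep i j ij nEij a.
by rewrite (resetC o (reset o a i) j k) !(resetC o a _ k) (fsep _ j).
Qed.

Lemma pairwise_separable_decomposable (Z : zmodType) (V : finType) (E : rel V)
    (S : V -> finType) (o : forall i : V, S i) (W : {set V})
    (f : profile S -> Z) :
  pairwise_separable E o f -> depends_on W f -> clique_decomposable E f.
Proof.
(* Strong induction on the size of [W], with [f] generalized because the three terms are new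
   functions. *)
have [n] := ubnP #|W|; elim: n => // n IHn in W f *; rewrite ltnS => leWn fsep fW.
have [Wclique|] := boolP (clique E W).
  exact: clique_decomposable_clique o W f Wclique fW.
rewrite negb_forall => /existsP[i]; rewrite negb_imply => /andP[iW].
rewrite negb_forall => /existsP[j]; rewrite negb_imply => /andP[jW].
rewrite negb_imply => /andP[ij nEij].
have reset_dec k (g : profile S -> Z) : k \in W -> pairwise_separable E o g -> depends_on W g ->
    clique_decomposable E (fun a => g (reset o a k)).
  move=> kW gsep gW; apply: (IHn (W :\ k)).
  - by apply: leq_trans leWn; rewrite (cardsD1 k W) kW.
  - exact: pairwise_separable_reset.
  - exact: depends_on_reset.
have [fC fCE] : clique_decomposable E (fun a =>
    f (reset o a i) + (f (reset o a j) - f (reset o (reset o a i) j))).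
  apply/clique_decomposableD; first exact: reset_dec.
  apply/clique_decomposableD; first exact: reset_dec.
  (* For the double reset, dependence on [W :\ j] is weakened back to [W]; resetting [i] alone
     already makes the set smaller. *)
  apply/clique_decomposableN/(reset_dec i (fun a => f (reset o a j))) => //.
    exact: pairwise_separable_reset.
  exact/(depends_on_subset (subsetDl W [set j]))/depends_on_reset.
by exists fC => a; rewrite -fCE -(fsep i j) // subrKC.
Qed.

(** Both differences of [Phi] are differences of [u i], which ignores the strategy of the
    nonneighbour [j]. *)
Lemma potential_pairwise_separable (R : realType) (V : finType) (E : rel V)
    (S : V -> finType) (o : forall i : V, S i)
    (u : V -> profile S -> R) (Phi : profile S -> R) :
  graphical_game o E u -> is_potential o u Phi -> pairwise_separable E o Phi.
Proof.
move=> ugr upot i j ij nEij a.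
by rewrite -upot (resetC o a i j) -upot -(resetC o a i j) -!(ugr i j).
Qed.

Theorem theorem4p1 (R : realType) (V : finType) (E : rel V)
    (E_sym : symmetric E) (E_irr : irreflexive E)
    (S : V -> finType) (o : forall i : V, S i)
    (u : V -> profile S -> R) (Phi : profile S -> R)
    (u_graphical : graphical_game o E u)
    (Phi_potential : is_potential o u Phi)
    (Phi_normalized : normalized Phi) :
  exists PhiC : forall C : {set V}, subprofile S C -> R,
    forall a : profile S,
      Phi a = \sum_(C in maximal_cliques E) PhiC C (restrict C a).
Proof.
(* The induction starts from all of [V], on which every function of profiles depends. *)
apply: (@pairwise_separable_decomposable _ _ _ _ o setT).
  exact: potential_pairwise_separable u_graphical Phi_potential.
by move=> a b ab; congr (Phi _); apply/ffunP => i; apply: ab; rewrite inE.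
Qed.
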